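(* Let $\mathcal{S}=\{\mathbf{y}\in\mathbb{R}^{d_y}: \mathbf{m}_k^\top\mathbf{y}\le b_k,\ k=1,\dots,l\}$ be a bounded convex polytope with nonzero normals $\mathbf{m}_k$, and let $w_\eta(\mathbf{y})=\prod_{k=1}^l\Phi(\eta(b_k-\mathbf{m}_k^\top\mathbf{y}))$, $\eta>0$. Fix $\mathbf{x}$ and $\mathbf{a}$ and suppose the post-alteration distribution $P(\cdot\mid\mathbf{x},\mathring{\mathbf{a}})$ of $\mathbf{Y}$ has a density bounded by a constant $M$. Then, as $\eta\to\infty$, $$\Big|\mathbb{P}(\mathbf{Y}\in\mathcal{S}\mid\mathbf{x},\mathring{\mathbf{a}})-\mathbb{E}_{\mathbf{y}\sim P(\cdot\mid\mathbf{x},\mathring{\mathbf{a}})}[w_\eta(\mathbf{y})]\Big|=\mathcal{O}\!\left(\frac{\sqrt{\ln\eta}}{\eta}\right),$$ where the implied constant depends only on $\mathcal{S}$, $l$ and $M$.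
   Context: $\Phi$ is the standard normal CDF. $P(\cdot\mid\mathbf{x},\mathring{\mathbf{a}})$ is the distribution of the outcome $\mathbf{Y}$ given context $\mathbf{x}$ after the intervention setting the actionable variables $\mathbf{A}$ to $\mathbf{a}$. *)

(* Defs.v *)
From HB Require Import structures.
From mathcomp Require Import all_boot all_order all_algebra.
From mathcomp Require Import all_classical all_reals all_analysis.
Set Implicit Arguments. Unset Strict Implicit. Unset Printing Implicit Defensive.
Import Order.TTheory GRing.Theory Num.Theory.
Local Open Scope classical_set_scope.
Local Open Scope ring_scope.

Definition Phi {R : realType} (x : R) : R :=
  fine (normal_prob (0 : R) 1 `]-oo, x]).

(* Points of R^d are d-tuples of reals (carrying the product sigma-algebra). *)
Definition dotp {R : realType} (d : nat) (u v : d.-tuple R) : R :=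
  \sum_(i < d) tnth u i * tnth v i.

Definition polytope {R : realType} (d l : nat) (m : 'I_l -> d.-tuple R)
  (b : 'I_l -> R) : set (d.-tuple R) :=
  [set y | forall k : 'I_l, dotp (m k) y <= b k].

Definition w_eta {R : realType} (d l : nat) (m : 'I_l -> d.-tuple R)
  (b : 'I_l -> R) (eta : R) (y : d.-tuple R) : R :=
  \prod_(k < l) Phi (eta * (b k - dotp (m k) y)).

(* d-dimensional Lebesgue integral of a function on R^d, as the iterated
   one-dimensional Lebesgue integral (Tonelli: equals the integral w.r.t.
   the product Lebesgue measure for nonnegative measurable integrands). *)
Fixpoint leb_int {R : realType} (d : nat) : (d.-tuple R -> \bar R) -> \bar R :=
  match d return (d.-tuple R -> \bar R) -> \bar R with
  | 0 => fun g => g [tuple]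
  | d'.+1 => fun g =>
      (\int[@lebesgue_measure R]_x leb_int (fun t : d'.-tuple R => g [tuple of x :: t]))%E
  end.

Definition is_density {R : realType} (d : nat)
  (P : set (d.-tuple R) -> \bar R) (f : d.-tuple R -> R) : Prop :=
  measurable_fun [set: d.-tuple R] f /\ (forall y, 0 <= f y) /\
  forall A : set (d.-tuple R), measurable A ->
    P A = leb_int (fun y => (\1_A y * f y)%:E).

(* Main.v *)
Require Import Defs.
From HB Require Import structures.
From mathcomp Require Import all_boot all_order all_algebra.
From mathcomp Require Import all_classical all_reals all_analysis.
From mathcomp Require Import measurable_realfun lra ring.
Import Order.TTheory GRing.Theory Num.Theory.
Local Open Scope classical_set_scope.
Local Open Scope ring_scope.

Set Implicit Arguments.
Unset Strict Implicit.

(** Off the slabs |m_k . y - b_k| <= e_eta, with e_eta = sqrt (2 ln eta) / eta,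
    every factor of w_eta is within exp (- (eta e_eta)^2 / 2) = 1 / eta of 0
    or 1, so w_eta is within (l + 1) / eta of the indicator of S.  The points
    of the slabs that matter lie in the relaxed polytope
    {y | m_k . y <= b_k + e_eta}, which stays inside a fixed box; there each
    slab has volume O(e_eta), hence probability O(M e_eta).

    That the relaxed polytope is bounded (and empty for small e if S is empty)
    is read off from Fourier-Motzkin elimination: for a linear form u, the set
    of pairs (e, u . y) with y in the relaxed polytope is cut out by finitely
    many non-strict inequalities in two variables. *)

(** * Fourier-Motzkin elimination over an ordered field *)

Section polyhedra.
Context {R : realFieldType}.

(** Elimination of one unknown: a negative coefficient gives a lower bound [c k / a k] on [t], a
    positive one an upper bound [c j / a j], and compatibility is pairwise. Cross-multiplying keeps
    the conditions linear in [c], which will hold the remaining variables. *)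
Lemma linear_ineqs1P (J : finType) (a c : J -> R) :
  (exists t, forall j, a j * t <= c j) <->
  (forall j, a j = 0 -> 0 <= c j) /\
  (forall j k, 0 < a j -> a k < 0 -> a k * c j <= a j * c k).
Proof.
split=> [[t ht]|[h0 hpn]].
  split=> [j aj0|j k aj ak]; first by have := ht j; rewrite aj0 mul0r.
  have := ler_wpM2l (ltW aj) (ht k).
  have := ler_wnM2l (ltW ak) (ht j).
  lra.
have hpn' j k : 0 < a j -> a k < 0 -> c k / a k <= c j / a j.
  move=> aj ak; rewrite ler_pdivlMr// mulrAC ler_ndivrMr//.
  by rewrite mulrC [leRHS]mulrC hpn.
have suffP t : (forall j, 0 < a j -> t <= c j / a j) ->
    (forall j, a j < 0 -> c j / a j <= t) -> forall j, a j * t <= c j.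
  move=> hp hn j; case: (ltgtP (a j) 0) => aj.
  - by have := hn _ aj; rewrite ler_ndivrMr// mulrC.
  - by have := hp _ aj; rewrite ler_pdivlMr// mulrC.
  - by rewrite aj mul0r; exact: h0.
(* The witness is the largest lower bound if there is one, else the smallest upper bound, else 0. *)
have [[k0 ak0]|noneg] := pselect (exists k, a k < 0).
  have [k ak kmax] := @arg_maxP _ _ _ k0 (fun k => a k < 0) (fun k => c k / a k) ak0.
  by exists (c k / a k); apply: suffP => j aj; [exact: hpn'|exact: kmax].
have [[j0 aj0]|nopos] := pselect (exists j, 0 < a j).
  have [j aj jmin] := @arg_minP _ _ _ j0 (fun j => 0 < a j) (fun j => c j / a j) aj0.
  by exists (c j / a j); apply: suffP => k ak; [exact: jmin|exact: hpn'].
by exists 0; apply: suffP => j aj; [case: nopos|case: noneg]; exists j.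
Qed.

(** Points are infinite sequences of which only the first [n] entries count, so that the dimension
    can change without casts. *)
Definition polyhedral (n : nat) (Q : (nat -> R) -> Prop) : Prop :=
  exists (J : finType) (a : J -> nat -> R) (c : J -> R),
    forall y, Q y <-> forall j, \sum_(i < n) a j i * y i <= c j.

Lemma polyhedral_exists (n : nat) (Q : (nat -> R) -> Prop) :
  polyhedral n.+1 Q ->
  polyhedral n (fun y => exists t, Q (fun i => if i == n then t else y i)).
Proof.
move=> [J [a [c hQ]]].
(* [inl j] keeps a constraint free of the eliminated variable, and [inr (j, k)] combines an upper
   with a lower bound. All other indices carry the trivial constraint [0 <= 0]. *)
pose a' (s : J + J * J) i := match s with
  | inl j => if a j n == 0 then a j i else 0
  | inr (j, k) => if (0 < a j n) && (a k n < 0)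
                  then a j n * a k i - a k n * a j i else 0
  end.
pose c' (s : J + J * J) := match s with
  | inl j => if a j n == 0 then c j else 0
  | inr (j, k) => if (0 < a j n) && (a k n < 0)
                  then a j n * c k - a k n * c j else 0
  end.
exists (J + J * J)%type, a', c' => y.
pose S j := \sum_(i < n) a j i * y i.
have sumE t j : \sum_(i < n.+1) a j i * (if i == n :> nat then t else y i) =
    S j + a j n * t.
  rewrite big_ord_recr /= eqxx; congr (_ + _); apply: eq_bigr => i _.
  by rewrite ltn_eqF.
have -> : (exists t, Q (fun i => if i == n then t else y i)) <->
    (exists t, forall j, a j n * t <= c j - S j).
  split=> -[t ht]; exists t; first by move=> j; move/hQ: ht => /(_ j); rewrite sumE; lra.
  by apply/hQ => j; rewrite sumE; have := ht j; lra.
rewrite linear_ineqs1P; split=> [[h0 hpn] [j|[j k]]|h].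
- rewrite /=; case: eqP => [aj|_]; first by have := h0 _ aj; rewrite subr_ge0.
  by rewrite big1// => i _; rewrite mul0r.
- rewrite /=; case: ifPn => [/andP[aj ak]|_]; last first.
    by rewrite big1// => i _; rewrite mul0r.
  under eq_bigr do rewrite mulrBl -!mulrA.
  rewrite sumrB -!mulr_sumr -/(S j) -/(S k).
  by have := hpn _ _ aj ak; lra.
- split=> [j aj|j k aj ak].
    by have := h (inl j); rewrite /= aj eqxx subr_ge0.
  have := h (inr (j, k)); rewrite /= aj ak/=.
  under eq_bigr do rewrite mulrBl -!mulrA.
  rewrite sumrB -!mulr_sumr -/(S j) -/(S k); lra.
Qed.

Lemma polyhedral_project (n p : nat) (Q : (nat -> R) -> Prop) :
  polyhedral (n + p) Q ->
  polyhedral n (fun y => exists z, Q (fun i => if (i < n)%N then y i else z i)).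
Proof.
elim: p Q => [|p IH] Q.
  rewrite addn0 => -[J [a [c hQ]]]; exists J, a, c => y; rewrite -hQ.
  split=> [[z /hQ hz]|/hQ hy]; last first.
    by exists y; apply/hQ => j; under eq_bigr do rewrite if_same; exact: hy.
  apply/hQ => j; have := hz j; congr (_ <= _).
  by apply: eq_bigr => i _; rewrite ltn_ord.
rewrite addnS => /polyhedral_exists/IH[J [a [c hQ]]].
exists J, a, c => y; rewrite -hQ; split=> [[z hz]|[z [t hz]]].
  (* The first branch is never taken; it makes the two functions agree at [n + p] by form alone. *)
  exists z, (if (n + p < n)%N then y (n + p)%N else z (n + p)%N).
  rewrite (_ : (fun i => _) = fun i => if (i < n)%N then y i else z i)//.
  by apply/funext => i; case: eqP => // ->.
exists (fun i => if i == (n + p)%N then t else z i).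
rewrite (_ : (fun i => _) = fun i => if i == (n + p)%N then t
  else if (i < n)%N then y i else z i)//.
apply/funext => i; case: eqP => [->|//].
by rewrite ltnNge leq_addr.
Qed.

End polyhedra.

(** * Boundedness of the relaxed polytope *)

Section relaxed_polytope.
Context {R : realType} (d l : nat).
Implicit Types (m : 'I_l -> d.-tuple R) (b : 'I_l -> R) (u y : d.-tuple R).

(** The coefficients depend on neither [e] nor [t], so what is known at [e = 0] constrains them and
    carries over to [e > 0]. *)
Lemma relaxed_polytope_section m b u :
  exists (J : finType) (a1 a2 c : J -> R), forall e t,
    (exists y, (forall k, dotp (m k) y <= b k + e) /\ dotp u y = t) <->
    forall j, a1 j * e + a2 j * t <= c j.
Proof.
(* Coordinates: [z 0] is the relaxation, [z 1] the value of the form [u],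
   and [z i.+2] the [i]-th coordinate of the point. *)
pose Q (z : nat -> R) :=
  (forall k, \sum_(i < d) tnth (m k) i * z i.+2 <= b k + z 0) /\
  \sum_(i < d) tnth u i * z i.+2 = z 1.
have : polyhedral (2 + d) Q.
  (* [inl k] encodes the relaxed constraint; the two values of [inr] encode the equality as a pair
     of opposite inequalities. *)
  pose a (s : 'I_l + bool) (i : nat) := match i, s with
    | 0, inl _ => -1 | 0, inr _ => 0
    | 1, inl _ => 0 | 1, inr s => (-1) ^+ s
    | i.+2, inl k => nth 0 (m k) i
    | i.+2, inr s => - (-1) ^+ s * nth 0 u i
    end.
  pose c (s : 'I_l + bool) := match s with inl k => b k | inr _ => 0 end.
  exists ('I_l + bool)%type, a, c => z.
  have hk k : \sum_(i < 2 + d) a (inl k) i * z i =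
      \sum_(i < d) tnth (m k) i * z i.+2 - z 0.
    rewrite !big_ord_recl/= mulN1r mul0r add0r addrC; congr (_ - _).
    by apply: eq_bigr => i _; rewrite (tnth_nth 0).
  have hs s : \sum_(i < 2 + d) a (inr s) i * z i =
      (-1) ^+ s * (z 1 - \sum_(i < d) tnth u i * z i.+2).
    rewrite !big_ord_recl/= mul0r add0r mulrBr; congr (_ + _).
    rewrite mulr_sumr -sumrN; apply: eq_bigr => i _.
    by rewrite (tnth_nth 0) !mulNr mulrA.
  split=> [[h1 h2] [k|s]|h].
  - by rewrite hk/=; have := h1 k; lra.
  - by rewrite hs h2 subrr mulr0.
  - split=> [k|]; first by have := h (inl k); rewrite hk/=; lra.
    have := h (inr true); have := h (inr false); rewrite !hs/= expr0 expr1; lra.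
move=> /polyhedral_project[J [a [c hJ]]].
exists J, (a ^~ 0%N), (a ^~ 1%N), c => e t.
have sum2 j : \sum_(i < 2) a j i * (if i == 0 :> nat then e else t) =
    a j 0 * e + a j 1 * t.
  by rewrite !big_ord_recl big_ord0 addr0.
have hJe := hJ (fun i => if i == 0 then e else t).
transitivity (forall j, \sum_(i < 2) a j i * (if i == 0 :> nat then e else t) <= c j);
  last by split=> h j; have := h j; rewrite sum2.
rewrite -hJe; split=> [[y [h1 h2]]|[z [h1 h2]]].
  have dotE v : \sum_(i < d) tnth v i * nth 0 y i = dotp v y.
    by rewrite /dotp; apply: eq_bigr => i _; rewrite (tnth_nth 0 y).
  by exists (fun i => nth 0 y i.-2); split=> [k|]; rewrite /= dotE.
have dotE v : dotp v [tuple z i.+2 | i < d] = \sum_(i < d) tnth v i * z i.+2.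
  by apply: eq_bigr => i _; rewrite tnth_mktuple.
by exists [tuple z i.+2 | i < d]; split=> [k|]; rewrite dotE; [exact: h1|exact: h2].
Qed.

(** With the zero form and [t = 0], the feasible [e] satisfy finitely many conditions
    [a1 j * e <= c j]. If [e = 0] fails, some [c j] is negative, and that condition still fails for
    small [e]. *)
Lemma relaxed_polytope_empty m b :
  ~ (exists y, polytope m b y) ->
  exists2 e, 0 < e & ~ exists y, forall k, dotp (m k) y <= b k + e.
Proof.
move=> S0; have [J [a1 [a2 [c hJ]]]] := relaxed_polytope_section m b [tuple 0 | _ < d].
have dot0 y : dotp [tuple 0 | _ < d] y = 0.
  by rewrite /dotp big1// => i _; rewrite tnth_mktuple mul0r.
have [j cj] : exists j, c j < 0.
  apply: contrapT => /forallNP hc; apply: S0.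
  have [|y [hy _]] := (hJ 0 0).2.
    by move=> j; rewrite !mulr0 addr0 leNgt; apply/negP.
  by exists y => k; have := hy k; rewrite addr0.
have den : 0 < 1 + `|a1 j| by rewrite ltr_wpDr.
(* This [e] satisfies [|a1 j| * e < - c j], hence [a1 j * e > c j]; the added 1 gives strictness and
   a nonzero denominator. *)
exists (- c j / (1 + `|a1 j|)); first by rewrite divr_gt0// oppr_gt0.
move=> [y hy].
have /hJ/(_ j) : exists y, (forall k, dotp (m k) y <= b k + (- c j / (1 + `|a1 j|)))
    /\ dotp [tuple 0 | _ < d] y = 0 by exists y.
rewrite mulr0 addr0 mulrA ler_pdivrMr//.
by have := ler_norm (- a1 j); rewrite normrN; nra.
Qed.

(** Some inequality has [a2 j > 0]: otherwise, at [e = 0], [t] could be raised from its value at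
    [y0] up to [r + 1]. That inequality then bounds [t] for every [e]. *)
Lemma relaxed_polytope_ub m b u (e r : R) :
  (exists y, polytope m b y) ->
  (forall y, polytope m b y -> dotp u y <= r) ->
  exists s, forall y, (forall k, dotp (m k) y <= b k + e) -> dotp u y <= s.
Proof.
move=> [y0 Sy0] hr; have [J [a1 [a2 [c hJ]]]] := relaxed_polytope_section m b u.
have S0 y : polytope m b y -> forall k, dotp (m k) y <= b k + 0.
  by move=> Sy k; rewrite addr0; exact: Sy.
have [j aj] : exists j, 0 < a2 j.
  apply: contrapT => /forallNP ha.
  have y0J : forall j, a1 j * 0 + a2 j * dotp u y0 <= c j.
    by apply/hJ; exists y0; split=> //; exact: S0.
  have [|y [hy yr]] := (hJ 0 (r + 1)).2.
    move=> j; apply: le_trans (y0J j); rewrite lerD2l.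
    rewrite ler_wnM2l//; first by rewrite leNgt; apply/negP.
    by rewrite (le_trans (hr _ Sy0))// lerDl.
  have /hr : polytope m b y by move=> k; have := hy k; rewrite addr0.
  by rewrite yr; lra.
exists ((c j - a1 j * e) / a2 j) => y hy.
have /hJ/(_ j) : exists y', (forall k, dotp (m k) y' <= b k + e) /\
    dotp u y' = dotp u y by exists y.
by rewrite ler_pdivlMr//; lra.
Qed.

Lemma relaxed_polytope_bounded m b (r : R) :
  (forall y, polytope m b y -> forall i, `|tnth y i| <= r) ->
  exists e s : R, [/\ 0 < e, 0 <= s & forall y,
    (forall k, dotp (m k) y <= b k + e) -> forall i, `|tnth y i| <= s].
Proof.
move=> hr; have [S0|S0] := pselect (exists y, polytope m b y); last first.
  have [e e0 he] := relaxed_polytope_empty S0.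
  by exists e, 0; split=> // y hy; case: he; exists y.
have dotD i x y : dotp [tuple x *+ (j == i) | j < d] y = x * tnth y i.
  rewrite /dotp (bigD1 i)//= tnth_mktuple eqxx mulr1n big1 ?addr0// => j ji.
  by rewrite tnth_mktuple (negbTE ji) mul0r.
(* Used with [x = 1] and [x = -1], to bound each coordinate from both sides. *)
have hub i x : `|x| = 1 -> exists s, forall y,
    (forall k, dotp (m k) y <= b k + 1) -> x * tnth y i <= s.
  move=> x1; have [|s hs] := @relaxed_polytope_ub m b [tuple x *+ (j == i) | j < d] 1 r S0.
    move=> y Sy; rewrite dotD (le_trans (ler_norm _))// normrM x1 mul1r.
    exact: hr.
  by exists s => y /hs; rewrite dotD.
have /choice[s hs] i : exists s, forall y,
    (forall k, dotp (m k) y <= b k + 1) -> `|tnth y i| <= s.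
  have [s1 hs1] := hub i 1 (normr1 _).
  have [|s2 hs2] := hub i (-1); first by rewrite normrN1.
  exists (Num.max s1 s2) => y hy; rewrite ler_norml lerNl !le_max.
  have := hs1 _ hy; have := hs2 _ hy; rewrite mulN1r mul1r => -> ->.
  by rewrite orbT.
exists 1, (\sum_i `|s i|); split=> // [|y hy i]; first exact: sumr_ge0.
rewrite (le_trans (hs i y hy))// (le_trans (ler_norm _))//.
by rewrite (bigD1 i)//= lerDl sumr_ge0.
Qed.

End relaxed_polytope.

(** * Gaussian tail bounds for [Phi] *)

Section gaussian_tail.
Context {R : realType}.
Implicit Types x u : R.

Let N01 : set R -> \bar R := normal_prob (0 : R) 1.

(* For [u * x >= u ^ 2] the centred density is at most
   [expR (- u ^ 2 / 2)] times the density shifted by [u]. *)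
Lemma normal_prob_shift_le (A : set R) u : measurable A ->
  (forall x, A x -> u ^+ 2 <= u * x) ->
  (normal_prob 0 1 A <= (expR (- (u ^+ 2) / 2))%:E)%E.
Proof.
move=> mA hA; set K := expR _.
have mpdf v : measurable_fun A (fun x => (normal_pdf v 1 x)%:E).
  by apply/measurable_EFinP; apply: measurable_funTS; exact: measurable_normal_pdf.
apply: (@le_trans _ _ (\int[lebesgue_measure]_(x in A) (K%:E * (normal_pdf u 1 x)%:E))%E).
  apply: ge0_le_integral => //.
  - by move=> x _; rewrite lee_fin normal_pdf_ge0.
  - exact: mpdf.
  - by apply: measurable_funeM; exact: mpdf.
  - move=> x Ax; rewrite -EFinM lee_fin !normal_pdfE//= mulrCA.
    rewrite ler_wpM2l ?normal_peak_ge0// /normal_fun /K -expRD ler_expR.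
    by have := hA _ Ax; lra.
rewrite ge0_integralZl//=.
- rewrite -[leRHS]mule1 lee_wpmul2l ?lee_fin ?expR_ge0//.
  exact: (@probability_le1 _ _ _ (normal_prob u 1)).
- exact: mpdf.
- by move=> x _; rewrite lee_fin normal_pdf_ge0.
- by rewrite lee_fin expR_ge0.
Qed.

Lemma EFin_Phi x : (Phi x)%:E = N01 `]-oo, x].
Proof. by rewrite /Phi fineK// fin_num_measure. Qed.

Lemma Phi_ge0 x : 0 <= Phi x.
Proof. by rewrite -lee_fin EFin_Phi. Qed.

Lemma Phi_le1 x : Phi x <= 1.
Proof. by rewrite -lee_fin EFin_Phi probability_le1. Qed.

Lemma Phi_nondecreasing : {homo @Phi R : x y / x <= y}.
Proof.
move=> x y xy; rewrite -lee_fin !EFin_Phi le_measure ?inE//.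
exact: subset_itvl.
Qed.

Lemma measurable_Phi : measurable_fun [set: R] (@Phi R).
Proof. by apply: nondecreasing_measurable => //; exact: Phi_nondecreasing. Qed.

Lemma Phi_lower_tail u x : 0 <= u -> x <= - u -> Phi x <= expR (- (u ^+ 2) / 2).
Proof.
(* The shift is by [- u], since the mass to be bounded lies to the left of [- u]. *)
move=> u0 xu; rewrite -lee_fin EFin_Phi -sqrrN.
apply: normal_prob_shift_le => // z; rewrite /= in_itv/= => zx.
by rewrite expr2 ler_wnM2l ?oppr_le0// (le_trans zx).
Qed.

Lemma Phi_upper_tail u x : 0 <= u -> u <= x -> 1 - Phi x <= expR (- (u ^+ 2) / 2).
Proof.
move=> u0 ux; rewrite -lee_fin EFinB EFin_Phi -probability_setC//.
apply: normal_prob_shift_le => [|z]; first exact: measurableC.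
rewrite setCitvl /= in_itv/= andbT => xz.
by rewrite expr2 ler_wpM2l// (le_trans ux)// ltW.
Qed.

End gaussian_tail.

(** * Volume bounds through the iterated integral *)

Section leb_int.
Import HBNNSimple.
Context {R : realType}.

(* [ge0_le_integral] would require the inner integrals of [leb_int] to be
   measurable in the outer variable. *)
Lemma ge0_le_integralT (d : measure_display) (T : measurableType d)
    (mu : {measure set T -> \bar R}) (f g : T -> \bar R) :
  (forall x, 0 <= f x)%E -> (forall x, f x <= g x)%E ->
  (\int[mu]_x f x <= \int[mu]_x g x)%E.
Proof.
move=> f0 fg; rewrite !ge0_integralTE//; last by move=> x; exact: le_trans (fg x).
apply: ereal_sup_le => _ [h /= hf <-]; exists h => // x.
exact: le_trans (fg x).
Qed.

Lemma leb_int_ge0 (d : nat) (g : d.-tuple R -> \bar R) :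
  (forall y, 0 <= g y)%E -> (0 <= leb_int g)%E.
Proof.
elim: d g => [|d IH] g g0 /=; first exact: g0.
by apply: integral_ge0 => x _; exact: IH.
Qed.

Lemma ge0_le_leb_int (d : nat) (f g : d.-tuple R -> \bar R) :
  (forall y, 0 <= f y)%E -> (forall y, f y <= g y)%E ->
  (leb_int f <= leb_int g)%E.
Proof.
elim: d f g => [|d IH] f g f0 fg /=; first exact: fg.
by apply: ge0_le_integralT => x; [exact: leb_int_ge0|exact: IH].
Qed.

Lemma leb_int0 (d : nat) : leb_int (fun _ : d.-tuple R => 0%E) = 0%E :> \bar R.
Proof.
elim: d => [//|d IH] /=; under eq_integral do rewrite IH; exact: integral0.
Qed.

(** Cavalieri-type bound: as a function of the first coordinate, the slice integral is dominated by
    [K] times the indicator of [[a, b]]. *)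
Lemma leb_int_cons_le (d : nat) (g : d.+1.-tuple R -> \bar R) (a b K : R) :
  a <= b -> 0 <= K -> (forall y, 0 <= g y)%E ->
  (forall x (y : d.-tuple R), ~ (a <= x <= b)%R -> g [tuple of x :: y] = 0)%E ->
  (forall x, leb_int (fun t => g [tuple of x :: t]) <= K%:E)%E ->
  (leb_int g <= (K * (b - a))%:E)%E.
Proof.
move=> ab K0 g0 gout gK /=.
apply: (@le_trans _ _ (\int[lebesgue_measure]_x (K%:E * (\1_`[a, b] x)%:E))%E).
  apply: ge0_le_integralT => x; first exact: leb_int_ge0.
  rewrite indicE; have [xab|/negP xab] := boolP (a <= x <= b).
    by rewrite mem_set /= ?in_itv//= mule1.
  rewrite memNset /= ?in_itv//= mule0.
  under [X in leb_int X]funext do rewrite gout//.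
  by rewrite leb_int0.
rewrite ge0_integralZl//=; last first.
  by apply/measurable_EFinP; exact: measurable_indic.
rewrite integral_indic// setIT /= lebesgue_measure_itv/= lte_fin.
by case: ifPn => _; rewrite -EFinM lee_fin// mulr0 mulr_ge0// subr_ge0.
Qed.

(** Truncated to a box, because in dimension at least 2 a full slab of positive width has infinite
    volume. *)
Definition slab (d : nat) (r : R) (u : d.-tuple R) (c e : R) : set (d.-tuple R) :=
  [set y | (forall i, `|tnth y i| <= r) /\ `|dotp u y - c| <= e].

(** Each coordinate contributes a factor [2 * r], so the induction builds the constant
    [M * (2 * r) ^+ d]. *)
Lemma leb_int_box_le (d : nat) (r M : R) : 0 <= r -> 0 <= M ->
  exists2 K, 0 <= K &
  (leb_int (fun y : d.-tuple R => (M * \1_[set y | forall i, (`|tnth y i| <= r)%R] y)%:E)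
    <= K%:E)%E.
Proof.
move=> r0 M0; elim: d => [|d [K K0 hK]].
  by exists M => //=; rewrite lee_fin ler_piMr// indicE; case: (_ \in _).
exists (K * (r - - r)); first by rewrite mulr_ge0// opprK addr_ge0.
apply: leb_int_cons_le => //.
- by rewrite ge0_cp.
- by move=> y; rewrite lee_fin mulr_ge0.
- move=> x y xr; rewrite indicE memNset ?mulr0//= => /(_ ord0).
  by rewrite tnth0 ler_norml.
- move=> x; apply: le_trans hK; apply: ge0_le_leb_int => y.
    by rewrite lee_fin mulr_ge0.
  rewrite lee_fin ler_wpM2l// !indicE ler_nat; case: (boolP (_ \in _)) => //.
  rewrite inE/= => h; rewrite mem_set//= => i.
  by have := h (lift ord0 i); rewrite tnthS.
Qed.

Lemma dotp_cons (d : nat) (x z : R) (u y : d.-tuple R) :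
  dotp [tuple of x :: u] [tuple of z :: y] = x * z + dotp u y.
Proof.
rewrite /dotp big_ord_recl !tnth0; congr (_ + _).
by apply: eq_bigr => i _; rewrite !tnthS.
Qed.

Lemma leb_int_slab_le (d : nat) (r M : R) (u : d.-tuple R) : 0 <= r -> 0 <= M ->
  u != [tuple 0 | _ < d] ->
  exists2 K, 0 <= K & forall c e, 0 <= e ->
    (leb_int (fun y => (M * \1_(slab r u c e) y)%:E) <= (K * e)%:E)%E.
Proof.
move=> r0 M0; elim: d u => [|d IH] u; first by rewrite [u]tuple0 [mktuple _]tuple0 eqxx.
case/tupleP: u => u0 v uneq.
(* If the tail [v] of the normal is nonzero, slice along the first coordinate,
   which ranges over [-r, r]; otherwise the slab only constrains that coordinate,
   to an interval of length [2 * e / `|u0|]. *)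
have [v0|/IH[K K0 hK]] := eqVneq v [tuple 0 | _ < d]; last first.
  exists (K * (r - - r)) => [|c e e0]; first by rewrite mulr_ge0// opprK addr_ge0.
  rewrite mulrAC; apply: leb_int_cons_le => //.
  - by rewrite ge0_cp.
  - by rewrite mulr_ge0.
  - by move=> y; rewrite lee_fin mulr_ge0.
  - move=> x y xr; rewrite indicE memNset ?mulr0//= => -[/(_ ord0)].
    by rewrite tnth0 ler_norml.
  (* The slice at [x] lies in a slab of normal [v] with offset [c - u0 * x]; hence the need for a
     [K] uniform in [c]. *)
  - move=> x; apply: le_trans (hK (c - u0 * x) e e0); apply: ge0_le_leb_int => y.
      by rewrite lee_fin mulr_ge0.
    rewrite lee_fin ler_wpM2l// !indicE ler_nat; case: (boolP (_ \in _)) => //.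
    rewrite inE/= => -[hy hd]; rewrite mem_set//=; split.
      by move=> i; have := hy (lift ord0 i); rewrite tnthS.
    by move: hd; rewrite dotp_cons; congr (`|_| <= _); ring.
have u0_neq0 : u0 != 0.
  apply: contra_neq uneq => u00; apply: eq_from_tnth => i.
  rewrite tnth_mktuple; case: (unliftP ord0 i) => [j|] ->; last by rewrite tnth0.
  by rewrite tnthS v0 tnth_mktuple.
have [K K0 hK] := leb_int_box_le d r0 M0.
exists (K * (2 / `|u0|)) => [|c e e0]; first by rewrite mulr_ge0// divr_ge0.
have u0gt : 0 < `|u0| by rewrite normr_gt0.
have -> : K * (2 / `|u0|) * e = K * ((c / u0 + e / `|u0|) - (c / u0 - e / `|u0|)).
  by rewrite -mulrA; congr (_ * _); generalize (c / u0) `|u0|^-1 => p q; ring.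
have vdot y : dotp v y = 0.
  by rewrite v0 /dotp big1// => i _; rewrite tnth_mktuple mul0r.
apply: leb_int_cons_le => //.
- by rewrite lerD2l ge0_cp// divr_ge0.
- by move=> y; rewrite lee_fin mulr_ge0.
- move=> x y xr; rewrite indicE memNset ?mulr0//= => -[_].
  rewrite dotp_cons vdot addr0 => h; apply: xr.
  rewrite -ler_distl -(ler_pM2l u0gt) -normrM mulrBr.
  by rewrite (mulrCA `|u0|) (mulrCA u0) !divff ?normr_eq0// !mulr1.
- move=> x; apply: le_trans hK; apply: ge0_le_leb_int => y.
    by rewrite lee_fin mulr_ge0.
  rewrite lee_fin ler_wpM2l// !indicE ler_nat; case: (boolP (_ \in _)) => //.
  rewrite inE/= => -[h _]; rewrite mem_set//= => i.
  by have := h (lift ord0 i); rewrite tnthS.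
Qed.

End leb_int.

(** * Pointwise and integrated smoothing error *)

Section smoothing_error.
Context {R : realType}.

Lemma onem_prod_le (I : finType) (p : I -> R) : (forall i, 0 <= p i <= 1) ->
  1 - \prod_i p i <= \sum_i (1 - p i).
Proof.
(* The induction for this union bound must also carry that partial products stay in [[0, 1]]. *)
move=> p01; have : 0 <= \prod_i p i <= 1 /\ 1 - \prod_i p i <= \sum_i (1 - p i).
  apply: (big_ind2 (fun x y : R => 0 <= x <= 1 /\ 1 - x <= y)) => [|x1 y1 x2 y2|i _].
  - by rewrite subrr ler01 lexx.
  - move=> [/andP[x10 x11] h1] [/andP[x20 x21] h2].
    by rewrite mulr_ge0// mulr_ile1//; split=> //; nra.
  - by rewrite p01.
by case.
Qed.

Context (d l : nat).
Implicit Types (m : 'I_l -> d.-tuple R) (b : 'I_l -> R) (y : d.-tuple R).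

Lemma w_eta_01 m b eta y : 0 <= w_eta m b eta y <= 1.
Proof.
rewrite /w_eta prodr_ge0/=; last by move=> k _; exact: Phi_ge0.
by apply: prodr_ile1 => k _; rewrite Phi_ge0 Phi_le1.
Qed.

(** On a slab the sum is at least 1, which dominates the error. Off the slabs the error is at most
    [l * t] inside the polytope, by the union bound, and at most [t] outside, from a single small
    factor; [l.+1] covers both. *)
Lemma indic_polytope_w_eta_le m b (eta e r : R) y : 0 < eta -> 0 <= e ->
  (forall y, (forall k, dotp (m k) y <= b k + e) -> forall i, `|tnth y i| <= r) ->
  `|\1_(polytope m b) y - w_eta m b eta y| <=
    l.+1%:R * expR (- (eta * e) ^+ 2 / 2) + \sum_k \1_(slab r (m k) (b k) e) y.
Proof.
move=> eta0 e0 hr; set t := expR _.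
have t0 : 0 <= t by exact: expR_ge0.
have ee0 : 0 <= eta * e by rewrite mulr_ge0// ltW.
have /andP[w0 w1] := w_eta_01 m b eta y.
have sum0 : 0 <= \sum_k \1_(slab r (m k) (b k) e) y :> R by exact: sumr_ge0.
have [[k yk]|nslab] := pselect (exists k, slab r (m k) (b k) e y).
  have : 1 <= \sum_k \1_(slab r (m k) (b k) e) y :> R.
    by rewrite (bigD1 k)//= indicE mem_set// lerDl sumr_ge0.
  have : 0 <= l.+1%:R * t by rewrite mulr_ge0.
  rewrite ler_norml indicE; case: (_ \in _) => /=; lra.
have far k : (forall i, `|tnth y i| <= r) -> e < `|dotp (m k) y - b k|.
  by move=> hy; rewrite ltNge; apply/negP => h; apply: nslab; exists k.
suff : `|\1_(polytope m b) y - w_eta m b eta y| <= l.+1%:R * t by lra.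
rewrite indicE; case: (boolP (y \in _)); rewrite ?inE ?notin_setE => yS.
  rewrite ger0_norm ?subr_ge0//.
  apply: (@le_trans _ _ (\sum_(k < l) t)); last first.
    by rewrite sumr_const card_ord -[t *+ l]mulr_natl ler_wpM2r// ler_nat.
  apply: (le_trans (onem_prod_le _)) => [k|]; first by rewrite Phi_ge0 Phi_le1.
  apply: ler_sum => k _; apply: Phi_upper_tail => //.
  rewrite ler_pM2l//.
  have /(far k) : forall i, `|tnth y i| <= r.
    by apply: hr => j; rewrite (le_trans (yS j))// lerDl.
  by rewrite ler0_norm ?subr_le0 ?opprB; [exact: ltW|exact: yS].
(* Otherwise [y] lies in the relaxed polytope, hence in the box, and any constraint it violates puts
   it in a slab. *)
have [k hk] : exists k, b k + e < dotp (m k) y.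
  apply: contrapT => /forallNP hn.
  have hy k : dotp (m k) y <= b k + e by rewrite leNgt; exact/negP.
  apply: yS => k; rewrite leNgt; apply/negP => bk.
  have := far k (hr y hy); rewrite ger0_norm ?subr_ge0 ?(ltW bk)//.
  by have := hy k; lra.
rewrite sub0r normrN ger0_norm//.
apply: (@le_trans _ _ t); last by rewrite ler_peMl// ler1n.
rewrite /w_eta (bigD1 k)//=.
apply: (@le_trans _ _ (Phi (eta * (b k - dotp (m k) y)))).
  rewrite ler_piMr ?Phi_ge0//.
  by apply: prodr_ile1 => j _; rewrite Phi_ge0 Phi_le1.
by apply: Phi_lower_tail => //; rewrite -mulrN ler_pM2l//; lra.
Qed.

Lemma measurable_dotp (u : d.-tuple R) : measurable_fun [set: d.-tuple R] (dotp u).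
Proof.
apply: measurable_sum => i; apply: measurable_funM => //.
exact: measurable_tnth.
Qed.

Lemma measurable_forall (n : nat) (A : 'I_n -> set (d.-tuple R)) :
  (forall k, measurable (A k)) -> measurable [set y | forall k, A k y].
Proof.
move=> mA; rewrite (_ : [set _ | _] = \bigcap_(k in [set: 'I_n]) A k).
  by apply: fin_bigcap_measurable.
by apply/seteqP; split=> y /= h k; [move=> _|]; exact: h.
Qed.

Lemma measurable_polytope m b : measurable (polytope m b).
Proof.
apply: (@measurable_forall _ (fun k => [set y | dotp (m k) y <= b k])) => k.
rewrite -[X in measurable X]setTI.
have := measurable_dotp (m k) measurableT (measurable_itv `]-oo, b k]).
by congr (measurable (_ `&` _)); apply/seteqP; split=> y; rewrite /= in_itv.
Qed.

Lemma measurable_slab r (u : d.-tuple R) c e : measurable (slab r u c e).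
Proof.
have mle (f : d.-tuple R -> R) x : measurable_fun setT f ->
    measurable [set y | `|f y| <= x].
  move=> mf; rewrite -[X in measurable X]setTI.
  have := mf measurableT _ (measurable_itv `[- x, x]).
  by congr (measurable (_ `&` _)); apply/seteqP; split=> y; rewrite /= in_itv/= ler_norml.
apply: measurableI; last first.
  by apply: mle; apply: measurable_funB => //; exact: measurable_dotp.
apply: (@measurable_forall _ (fun i => [set y | `|tnth y i| <= r])) => i.
by apply: mle; exact: measurable_tnth.
Qed.

Lemma measurable_w_eta m b eta : measurable_fun setT (w_eta m b eta).
Proof.
apply: measurable_prod => k _.
apply: (measurableT_comp measurable_Phi).
apply: measurable_funM => //; apply: measurable_funB => //; exact: measurable_dotp.
Qed.

Lemma bounded_density_slab_le (P : probability (d.-tuple R) R)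
    (f : d.-tuple R -> R) (M r K c e : R) (u : d.-tuple R) :
  is_density P f -> (forall y, f y <= M) ->
  (leb_int (fun y => (M * \1_(slab r u c e) y)%:E) <= (K * e)%:E)%E ->
  (P (slab r u c e) <= (K * e)%:E)%E.
Proof.
move=> [_ [f0 fP]] fM; apply: le_trans; rewrite fP; last exact: measurable_slab.
apply: ge0_le_leb_int => y; rewrite lee_fin.
  by rewrite mulr_ge0.
by rewrite mulrC ler_wpM2r.
Qed.

(** The pointwise bound is integrated against [P], whose total mass 1 leaves the constant term
    unchanged. *)
Lemma polytope_smoothing_error_le (P : probability (d.-tuple R) R) m b
    (eta e r : R) : 0 < eta -> 0 <= e ->
  (forall y, (forall k, dotp (m k) y <= b k + e) -> forall i, `|tnth y i| <= r) ->
  (`| P (polytope m b) - \int[P]_y (w_eta m b eta y)%:E | <=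
    (l.+1%:R * expR (- (eta * e) ^+ 2 / 2))%:E +
    \sum_k P (slab r (m k) (b k) e))%E.
Proof.
move=> eta0 e0 hr; set t := l.+1%:R * _.
have t0 : 0 <= t by rewrite mulr_ge0// expR_ge0.
have mS := measurable_polytope m b.
have iS : P.-integrable setT (EFin \o \1_(polytope m b)).
  exact: integrable_indic.
have iw : P.-integrable setT (EFin \o w_eta m b eta).
  apply: (@le_integrable _ _ _ P setT measurableT _ (EFin \o cst 1)).
  - by apply/measurable_EFinP; exact: measurable_w_eta.
  - move=> y _ /=; have /andP[w0 w1] := w_eta_01 m b eta y.
    by rewrite lee_fin normr1 ger0_norm.
  - exact: finite_measure_integrable_cst.
have -> : P (polytope m b) = (\int[P]_y (\1_(polytope m b) y)%:E)%E.
  by rewrite integral_indic// setIT.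
rewrite -integralB_EFin//.
apply: le_trans (le_abse_integral _ _ _) _ => //.
  by apply/measurable_EFinP/measurable_funB => //; exact: measurable_w_eta.
apply: (@le_trans _ _ (\int[P]_y (t%:E +
    \sum_k (\1_(slab r (m k) (b k) e) y)%:E))%E).
  apply: ge0_le_integralT => // y; rewrite sumEFin -EFinD lee_fin.
  exact: indic_polytope_w_eta_le.
have mI k : measurable_fun setT (fun y => (\1_(slab r (m k) (b k) e) y)%:E : \bar R).
  by apply/measurable_EFinP/measurable_indic; exact: measurable_slab.
rewrite ge0_integralD//=; first last.
- exact: emeasurable_sum.
- by move=> y _; apply: sume_ge0 => k _; rewrite lee_fin.
rewrite integral_cst// [X in (t%:E * X)%E]probability_setT mule1 leeD2l//.
rewrite ge0_integral_sum//; apply: lee_sum => k _.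
by rewrite integral_indic ?setIT//; exact: measurable_slab.
Qed.

End smoothing_error.

(** * The asymptotic rate *)

Unset Implicit Arguments.
Set Strict Implicit.

Theorem theorem1 (R : realType) (d l : nat) (m : 'I_l -> d.-tuple R)
    (b : 'I_l -> R)
    (hm : forall k : 'I_l, m k != [tuple (0 : R) | _ < d])
    (hbounded : exists r : R, forall y, polytope m b y ->
                  forall i : 'I_d, `|tnth y i| <= r)
    (M : R) :
  exists C : R, exists eta0 : R,
    forall (P : probability (d.-tuple R) R) (f : d.-tuple R -> R),
      is_density P f -> (forall y, f y <= M) ->
      forall eta : R, 0 < eta -> eta0 <= eta ->
        (`| P (polytope m b) - \int[P]_y (w_eta m b eta y)%:E |
           <= (C * Num.sqrt (ln eta) / eta)%:E)%E.
Proof.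
have [r0 /relaxed_polytope_bounded[e0 [r [e0_gt0 r_ge0 hr]]]] := hbounded.
(* [|M|] stands in for [M], whose sign is not given. The constants [K k] are fixed before [P] and
   [f] appear. *)
have /choice[K hK] k : exists K, forall c e, 0 <= e ->
    (leb_int (fun y => (`|M| * \1_(slab r (m k) c e) y)%:E) <= (K * e)%:E)%E.
  have [K _ hK] := leb_int_slab_le r_ge0 (normr_ge0 M) (hm k).
  by exists K.
(* From [eta >= expR 1] follows [ln eta >= 1], so the [l.+1%:R / eta] term is absorbed. From
   [eta >= 2 / e0 ^+ 2] and [ln eta <= eta] follows [e ^+ 2 <= 2 / eta <= e0 ^+ 2]. The factor
   [Num.sqrt 2] comes from the width [e]. *)
exists (l.+1%:R + Num.sqrt 2 * \sum_k K k), (Num.max (expR 1) (2 / e0 ^+ 2)).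
move=> P f fP fM eta eta_gt0; rewrite ge_max => /andP[eta_e eta_e0].
have ln1 : 1 <= ln eta by rewrite -[1]expRK ler_ln ?posrE ?expR_gt0.
have ln0 : 0 <= ln eta by rewrite (le_trans _ ln1).
pose e := Num.sqrt (2 * ln eta) / eta.
have e_ge0 : 0 <= e by rewrite divr_ge0 ?sqrtr_ge0// ltW.
have eta_e2 : (eta * e) ^+ 2 = 2 * ln eta.
  by rewrite /e mulrCA divff ?gt_eqF// mulr1 sqr_sqrtr// mulr_ge0.
have e_le : e <= e0.
  rewrite -(@ler_pXn2r _ 2)// ?nnegrE ?(ltW e0_gt0)//.
  rewrite ler_pdivrMr ?exprn_gt0// in eta_e0.
  rewrite -(ler_pM2l (exprn_gt0 2 eta_gt0)) -exprMn eta_e2.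
  have := ln_sublinear eta_gt0; nra.
have hre y : (forall k, dotp (m k) y <= b k + e) -> forall i, `|tnth y i| <= r.
  by move=> hy; apply: hr => k; rewrite (le_trans (hy k))// lerD2l.
apply: le_trans (polytope_smoothing_error_le P eta_gt0 e_ge0 hre) _.
apply: (@le_trans _ _ ((l.+1%:R / eta)%:E + \sum_k (K k * e)%:E)%E).
  apply: leeD.
    rewrite eta_e2 lee_fin mulNr mulrC.
    rewrite (_ : - (2 * ln eta / 2) = - ln eta); last by field.
    by rewrite expRN lnK// mulrC.
  apply: lee_sum => k _; apply: (bounded_density_slab_le fP) (hK k (b k) e e_ge0).
  by move=> y; rewrite (le_trans (fM y))// ler_norm.
rewrite sumEFin -EFinD lee_fin -mulr_suml.
rewrite 2!mulrDl lerD//.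
  rewrite ler_wpM2r ?invr_ge0 ?(ltW eta_gt0)// ler_peMr//.
  by rewrite -[leLHS]sqrtr1 ler_sqrt.
rewrite /e sqrtrM// le_eqVlt; apply/orP; left; apply/eqP; ring.
Qed.
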